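(* In the Sedenions there are exactly $28$ Co-Assessor trios, and each of them is either a trefoil or a triple zigzag.
   Context: The Sedenions are the 16-dimensional real (non-associative, distributive) algebra with basis $1,i_1,\dots,i_{15}$, where $1$ is the unit, $i_n^2=-1$, $i_mi_n=-i_ni_m$ for $m\ne n$, and for each triplet $(a,b,c)$ in the following list $i_ai_b=i_c$, $i_bi_c=i_a$, $i_ci_a=i_b$. O-trips: (1,2,3),(1,4,5),(1,7,6),(2,4,6),(2,5,7),(3,4,7),(3,6,5). S-trips: (1,8,9),(1,11,10),(1,13,12),(1,14,15),(2,8,10),(2,9,11),(2,14,12),(2,15,13),(3,8,11),(3,10,9),(3,15,12),(3,13,14),(4,8,12),(4,9,13),(4,10,14),(4,11,15),(5,8,13),(5,12,9),(5,10,15),(5,14,11),(6,8,14),(6,15,9),(6,12,10),(6,11,13),(7,8,15),(7,9,14),(7,13,10),(7,12,11). Thus $i_mi_n=\pm i_{m\oplus n}$, where $\oplus$ is bitwise XOR. Two (unordered) pairs $(A,B)$, $(C,D)$ of distinct indices in $\{1,\dots,15\}$ are Co-Assessors if $(i_A+s\,i_B)(i_C+t\,i_D)=0$ for some signs $s,t\in\{+1,-1\}$. A pair $(A,B)$ is an Assessor if it is a Co-Assessor of some pair. A Co-Assessor trio is a set of three pairwise Co-Assessor Assessors $(A,B),(C,D),(E,F)$ in which the third arises from the first two by XOR, i.e. $\{E,F\}=\{A\oplus C,\;A\oplus D\}$. Each Assessor is written $(a,S)$ with $a<S$. The edge joining two Co-Assessors $(a,S)$, $(b,T)$ is marked $+$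 if $(i_a+i_S)(i_b+i_T)=0$ (like-signed diagonals annihilate) and $-$ if $(i_a+i_S)(i_b-i_T)=0$ (opposite-signed diagonals annihilate); exactly one of these holds. A trio is a triple zigzag if its three edges are all marked $-$, and a trefoil if exactly two of its edges are marked $+$ and one is marked $-$. *)

(* Defs.v *)
(* The sedenions are taken over an arbitrary model R : realType of
   the real numbers.  Only the ring structure of R enters the definitions. *)
From mathcomp Require Export all_boot all_order all_algebra.
From mathcomp Require Export reals.

Set Implicit Arguments.
Unset Strict Implicit.
Unset Printing Implicit Defensive.

Import GRing.Theory.
Local Open Scope ring_scope.

Definition O_trips : seq (nat * nat * nat) :=
  [:: (1,2,3); (1,4,5); (1,7,6); (2,4,6); (2,5,7); (3,4,7); (3,6,5)]%N.

Definition S_trips : seq (nat * nat * nat) :=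
  [:: (1,8,9); (1,11,10); (1,13,12); (1,14,15);
      (2,8,10); (2,9,11); (2,14,12); (2,15,13);
      (3,8,11); (3,10,9); (3,15,12); (3,13,14);
      (4,8,12); (4,9,13); (4,10,14); (4,11,15);
      (5,8,13); (5,12,9); (5,10,15); (5,14,11);
      (6,8,14); (6,15,9); (6,12,10); (6,11,13);
      (7,8,15); (7,9,14); (7,13,10); (7,12,11)]%N.

Definition trips := O_trips ++ S_trips.

(* i_a * i_b = i_c is one of the three products prescribed by a triplet. *)
Definition cyclic_trip (a b c : nat) : bool :=
  [|| (a, b, c) \in trips, (b, c, a) \in trips | (c, a, b) \in trips].

(* Coordinates of a sedenion in the basis 1 = i_0, i_1, ..., i_15. *)
Definition sedenion (R : nzRingType) := 'rV[R]_16.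

Definition i_ (R : nzRingType) (n : 'I_16) : sedenion R := delta_mx ord0 n.

(* The coefficient of i_k in the product i_m * i_n. *)
Definition sed_coef (R : nzRingType) (m n k : 'I_16) : R :=
  if m == ord0 then (n == k)%:R
  else if n == ord0 then (m == k)%:R
  else if m == n then - (k == ord0)%:R
  else if cyclic_trip m n k then 1
  else if cyclic_trip n m k then -1
  else 0.

Definition sed_mul (R : nzRingType) (x y : sedenion R) : sedenion R :=
  \row_k \sum_m \sum_n x ord0 m * y ord0 n * sed_coef R m n k.

(* An unordered pair of distinct indices in {1, ..., 15}. *)
Definition index_pair (P : {set 'I_16}) : bool :=
  (#|P| == 2) && (ord0 \notin P).

(* The booleans s, t encode the signs (-1)^s, (-1)^t. *)
Definition co_assessors (R : nzRingType) (P Q : {set 'I_16}) : bool :=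
  [&& index_pair P, index_pair Q &
   [exists A, exists B, exists C, exists D, exists s : bool, exists t : bool,
    [&& P == [set A; B], Q == [set C; D] &
        sed_mul (i_ R A + (-1) ^+ s *: i_ R B)
                (i_ R C + (-1) ^+ t *: i_ R D) == 0]]].

Definition assessor (R : nzRingType) (P : {set 'I_16}) : bool :=
  [exists Q, co_assessors R P Q].

Definition xor_third (P Q U : {set 'I_16}) : bool :=
  [exists A, exists B, exists C, exists D, exists E, exists F,
   [&& P == [set A; B], Q == [set C; D], U == [set E; F],
       E == Nat.lxor A C :> nat & F == Nat.lxor A D :> nat]].

Definition co_assessor_trio (R : nzRingType) (T : {set {set 'I_16}}) : bool :=
  (#|T| == 3) &&
  [exists P, exists Q, exists U,
   [&& T == [set P; Q; U],
       [&& assessor R P, assessor R Q & assessor R U],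
       [&& co_assessors R P Q, co_assessors R P U & co_assessors R Q U] &
       xor_third P Q U]].

Definition edge_plus (R : nzRingType) (P Q : {set 'I_16}) : bool :=
  co_assessors R P Q &&
  [exists a : 'I_16, exists S : 'I_16, exists b : 'I_16, exists T : 'I_16,
   [&& P == [set a; S], (a < S)%N, Q == [set b; T], (b < T)%N &
       sed_mul (i_ R a + i_ R S) (i_ R b + i_ R T) == 0]].

Definition edge_minus (R : nzRingType) (P Q : {set 'I_16}) : bool :=
  co_assessors R P Q &&
  [exists a : 'I_16, exists S : 'I_16, exists b : 'I_16, exists T : 'I_16,
   [&& P == [set a; S], (a < S)%N, Q == [set b; T], (b < T)%N &
       sed_mul (i_ R a + i_ R S) (i_ R b - i_ R T) == 0]].

Definition triple_zigzag (R : nzRingType) (T : {set {set 'I_16}}) : bool :=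
  co_assessor_trio R T &&
  [exists P, exists Q, exists U,
   [&& T == [set P; Q; U],
       edge_minus R P Q, edge_minus R P U & edge_minus R Q U]].

(* The two sums count, over the three edges, those marked + and those
   marked -. *)
Definition trefoil (R : nzRingType) (T : {set {set 'I_16}}) : bool :=
  co_assessor_trio R T &&
  [exists P, exists Q, exists U,
   [&& T == [set P; Q; U],
       (edge_plus R P Q + edge_plus R P U + edge_plus R Q U == 2)%N &
       (edge_minus R P Q + edge_minus R P U + edge_minus R Q U == 1)%N]].

(* Main.v *)
(** In the sedenions [i_m i_n = +- i_(m xor n)], so a product
    [(i_A + s i_B)(i_C + t i_D)] is a signed sum of the four basis vectors of
    indices [A xor C], [A xor D], [B xor C], [B xor D].  It vanishes exactly when
    [A xor B = C xor D], which makes these vectors coincide in pairs, and the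
    signs are opposite in both pairs; only the product [s t] matters.  Being
    co-assessors is thus a decidable condition on index pairs, and the trios and
    the marks of their edges are found by enumeration. *)
Require Import Defs.
From mathcomp Require Import all_boot all_order all_algebra.
From mathcomp Require Import reals.
From Stdlib Require PeanoNat.

Set Implicit Arguments.
Unset Strict Implicit.
Unset Printing Implicit Defensive.

Import Order.TTheory GRing.Theory Num.Theory.

(** * Indices *)

Lemma lxor_comm m n : Nat.lxor m n = Nat.lxor n m.
Proof. exact: PeanoNat.Nat.lxor_comm. Qed.

Lemma lxorKl m n : Nat.lxor m (Nat.lxor m n) = n.
Proof.
by rewrite -PeanoNat.Nat.lxor_assoc PeanoNat.Nat.lxor_nilpotent
           PeanoNat.Nat.lxor_0_l.
Qed.

Lemma lxor_injl m : injective (Nat.lxor m).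
Proof. exact: can_inj (lxorKl m). Qed.

Lemma lxor_injr m : injective (Nat.lxor^~ m).
Proof. by move=> n n'; rewrite lxor_comm (lxor_comm n') => /lxor_injl. Qed.

(** Cancelling [c] and [b] moves them across the equation. The implication [exch] swaps the two
    middle arguments, so it serves both directions. *)
Lemma lxor_exchange a b c d :
  (Nat.lxor a c == Nat.lxor b d) = (Nat.lxor a b == Nat.lxor c d).
Proof.
have exch x y z w : Nat.lxor x z = Nat.lxor y w -> Nat.lxor x y = Nat.lxor z w.
  move=> e; apply: (@lxor_injl z).
  rewrite lxorKl -PeanoNat.Nat.lxor_assoc (lxor_comm z) e.
  by rewrite lxor_comm lxorKl.
by apply/eqP/eqP; apply: exch.
Qed.

(** Moves a check over ['I_16] to lists of naturals, where [vm_compute] decides it. *)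
Lemma all2_ord16 (P : rel nat) :
  all (fun m => all (P m) (iota 0 16)) (iota 0 16) ->
  forall m n : 'I_16, P m n.
Proof.
move=> /allP rows m n.
have /rows/allP : val m \in iota 0 16 by rewrite mem_iota ltn_ord.
by apply; rewrite mem_iota ltn_ord.
Qed.

Lemma lxor_lt16 (m n : 'I_16) : Nat.lxor m n < 16.
Proof.
by apply: (@all2_ord16 (fun m n => Nat.lxor m n < 16)); vm_compute.
Qed.

Definition xor_ord (m n : 'I_16) : 'I_16 := Ordinal (lxor_lt16 m n).

Lemma xor_ord_injl m : injective (xor_ord m).
Proof. by move=> n n' /(congr1 val) /lxor_injl /val_inj. Qed.

Lemma xor_ord_injr m : injective (xor_ord^~ m).
Proof. by move=> n n' /(congr1 val) /lxor_injr /val_inj. Qed.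

Lemma cyclic_trip_xor m n k : cyclic_trip m n k -> k = Nat.lxor m n.
Proof.
have /allP tripsP : all (fun t => [&& t.2 == Nat.lxor t.1.1 t.1.2,
    t.1.2 == Nat.lxor t.2 t.1.1 & t.1.1 == Nat.lxor t.1.2 t.2]) trips.
  by vm_compute.
by case/or3P=> /tripsP /and3P[/eqP ? /eqP ? /eqP ?].
Qed.

(** The 35 triplets form a Steiner triple system on the 15 imaginary units: two distinct ones lie in
    exactly one triplet, which orients them one way only. *)
Lemma cyclic_trip_anti (m n : 'I_16) :
  m != ord0 -> n != ord0 -> m != n ->
  cyclic_trip n m (Nat.lxor m n) = ~~ cyclic_trip m n (Nat.lxor m n).
Proof.
move=> m0 n0 mn; apply/eqP.
have := @all2_ord16 (fun m n => [|| m == 0, n == 0, m == n |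
  cyclic_trip n m (Nat.lxor m n) == ~~ cyclic_trip m n (Nat.lxor m n)]).
move/(_ _ m n)/or4P=> [|/eqP m0'|/eqP n0'|/eqP mn'|//]; first by vm_compute.
- by case/eqP: m0; apply: val_inj.
- by case/eqP: n0; apply: val_inj.
- by case/eqP: mn; apply: val_inj.
Qed.

(** * Products *)

(** Sign bit of [i_m i_n] relative to the basis vector of index [m xor n]; the case [m == n]
    accounts for the squares [-1]. *)
Definition neg_prod (m n : nat) : bool :=
  [&& m != 0, n != 0 & (m == n) || ~~ cyclic_trip m n (Nat.lxor m n)].

Section Product.

Local Open Scope ring_scope.

Lemma sed_coefE (R : nzRingType) (m n k : 'I_16) :
  sed_coef R m n k = (-1) ^+ neg_prod m n * (k == xor_ord m n)%:R.
Proof.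
have negE : neg_prod m n = [&& m != ord0, n != ord0 &
    (m == n) || ~~ cyclic_trip m n (Nat.lxor m n)] by [].
rewrite {}negE /sed_coef.
have [->|m0] /= := eqVneq m ord0.
  rewrite mul1r (_ : xor_ord _ _ = n) 1?eq_sym //.
  by apply: val_inj; rewrite /= PeanoNat.Nat.lxor_0_l.
have [->|n0] /= := eqVneq n ord0.
  rewrite mul1r (_ : xor_ord _ _ = m) 1?eq_sym //.
  by apply: val_inj; rewrite /= PeanoNat.Nat.lxor_0_r.
have [->|mn] /= := eqVneq m n.
  rewrite mulN1r (_ : xor_ord _ _ = ord0) //.
  by apply: val_inj; rewrite /= PeanoNat.Nat.lxor_nilpotent.
have [->|kmn] := eqVneq k (xor_ord m n).
  by rewrite mulr1 /= cyclic_trip_anti //; case: cyclic_trip.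
have kmn' : k <> Nat.lxor m n :> nat.
  by move=> e; case/eqP: kmn; apply: val_inj.
(* Away from the index [m xor n], neither orientation can be a triplet. *)
rewrite mulr0; case: ifP => [/cyclic_trip_xor //|_].
by case: ifP => // /cyclic_trip_xor; rewrite lxor_comm.
Qed.

Variable R : comNzRingType.
Implicit Types x y z : sedenion R.

Lemma sed_mulDl x y z : sed_mul (x + y) z = sed_mul x z + sed_mul y z.
Proof.
apply/rowP=> k; rewrite !mxE -big_split; apply: eq_bigr => m _ /=.
by rewrite -big_split; apply: eq_bigr => n _ /=; rewrite mxE !mulrDl.
Qed.

Lemma sed_mulDr x y z : sed_mul x (y + z) = sed_mul x y + sed_mul x z.
Proof.
apply/rowP=> k; rewrite !mxE -big_split; apply: eq_bigr => m _ /=.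
by rewrite -big_split; apply: eq_bigr => n _ /=; rewrite mxE mulrDr mulrDl.
Qed.

Lemma sed_mulZl a x y : sed_mul (a *: x) y = a *: sed_mul x y.
Proof.
apply/rowP=> k; rewrite !mxE mulr_sumr; apply: eq_bigr => m _ /=.
by rewrite mulr_sumr; apply: eq_bigr => n _ /=; rewrite mxE !mulrA.
Qed.

Lemma sed_mulZr a x y : sed_mul x (a *: y) = a *: sed_mul x y.
Proof.
apply/rowP=> k; rewrite !mxE mulr_sumr; apply: eq_bigr => m _ /=.
by rewrite mulr_sumr; apply: eq_bigr => n _ /=; rewrite mxE mulrCA !mulrA.
Qed.

Lemma sed_mul_basis (m n : 'I_16) :
  sed_mul (i_ R m) (i_ R n) = (-1) ^+ neg_prod m n *: i_ R (xor_ord m n).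
Proof.
apply/rowP=> k; rewrite !mxE (bigD1 m) //= [X in _ + X]big1 => [|m' m'm].
  rewrite addr0 (bigD1 n) //= [X in _ + X]big1 => [|n' n'n].
    by rewrite !mxE !eqxx /= !mul1r addr0 sed_coefE.
  by rewrite !mxE (negPf n'n) andbF mulr0 mul0r.
by rewrite big1 // => n' _; rewrite !mxE (negPf m'm) andbF !mul0r.
Qed.

End Product.

(** [e] is the parity of the number of minus signs among the two diagonals. *)
Definition annih (e : bool) (p q : nat * nat) : bool :=
  if Nat.lxor p.1 p.2 == Nat.lxor q.1 q.2 then
    (neg_prod p.1 q.1 (+) neg_prod p.2 q.2 == ~~ e)
    && (neg_prod p.1 q.2 (+) neg_prod p.2 q.1 == ~~ e)
  else false.

(** Reversing a pair only exchanges the two sign conditions. *)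
Lemma annih_swapl e a b q : annih e (b, a) q = annih e (a, b) q.
Proof.
rewrite /annih /= (lxor_comm b a) andbC.
by rewrite (addbC (neg_prod b q.2)) (addbC (neg_prod b q.1)).
Qed.

Lemma annih_swapr e p c d : annih e p (d, c) = annih e p (c, d).
Proof. by rewrite /annih /= (lxor_comm d c) andbC. Qed.

(** * Vanishing of a product of two diagonals *)

Section Diagonals.

Local Open Scope ring_scope.
Variable R : numDomainType.

(** Equal signs add up to 2 or -2, which is nonzero in characteristic zero. *)
Lemma signr_add_eq0 (b c : bool) :
  ((-1) ^+ b + (-1) ^+ c == 0 :> R) = b (+) c.
Proof.
case: b; case: c; rewrite /= ?(expr0, expr1) ?addNr ?subrr ?eqxx //.
  by rewrite -opprD oppr_eq0 -mulr2n pnatr_eq0.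
by rewrite -mulr2n pnatr_eq0.
Qed.

Lemma sed_mul_diagonals_eq0 (A B C D : 'I_16) (s t : bool) :
  A != B -> C != D ->
  (sed_mul (i_ R A + (-1) ^+ s *: i_ R B) (i_ R C + (-1) ^+ t *: i_ R D) == 0)
    = annih (s (+) t) (val A, val B) (val C, val D).
Proof.
move=> AB CD.
rewrite !sed_mulDl !sed_mulDr !sed_mulZl !sed_mulZr !sed_mul_basis !scalerA.
rewrite -!signr_addb /annih /=.
set w := xor_ord A C; set x := xor_ord A D; set y := xor_ord B C.
set z := xor_ord B D.
(* Products sharing a factor have distinct indices, so only [w = z] and [x = y] are possible, and
   these are equivalent. *)
have wx : w == x = false by rewrite (inj_eq (@xor_ord_injl A)) (negPf CD).
have yz : y == z = false by rewrite (inj_eq (@xor_ord_injl B)) (negPf CD).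
have wy : w == y = false by rewrite (inj_eq (@xor_ord_injr C)) (negPf AB).
have xz : x == z = false by rewrite (inj_eq (@xor_ord_injr D)) (negPf AB).
have wzE : (w == z) = (Nat.lxor A B == Nat.lxor C D) by rewrite -lxor_exchange.
have xyE : (x == y) = (Nat.lxor A B == Nat.lxor C D).
  by rewrite (lxor_comm C) -lxor_exchange.
rewrite -wzE; apply/eqP/idP => [/rowP eq0|].
  (* If [w] differed from [z], the coordinate at [w] would be a lone sign, hence nonzero. *)
  have := eq0 w; rewrite !mxE /= eqxx wx wy !mulr0 !addr0 add0r mulr1.
  case: eqP wzE => [wz wzE|_ _ /eqP]; last by rewrite mulr0 addr0 signr_eq0.
  rewrite mulr1 => /eqP; rewrite signr_add_eq0 => parE.
  (* The coordinate at [x] yields the second sign condition. *)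
  have := eq0 x; rewrite !mxE /= eqxx xz xyE -wzE (eq_sym x) wx.
  rewrite !mulr0 addr0 add0r !mulr1 => /eqP; rewrite signr_add_eq0 => crossE.
  by case: s t parE crossE {eq0} => [] []; do 4! case: neg_prod.
case: eqP wzE => [wz wzE|//]; move: xyE; rewrite -wzE => /eqP <-.
rewrite -wz => /andP[parE crossE].
(* With [z = w] and [y = x], the four terms regroup into one multiple of each of two basis vectors;
   both coefficients are sums of opposite signs. *)
rewrite [X in _ + X]addrC addrACA -!scalerDl.
rewrite [X in X *: _](_ : _ = 0) ?scale0r ?add0r; last first.
  apply/eqP; rewrite signr_add_eq0.
  by case: s t parE {crossE} => [] []; do 2! case: neg_prod.
rewrite [X in X *: _](_ : _ = 0) ?scale0r //.
apply/eqP; rewrite signr_add_eq0.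
by case: s t crossE {parE} => [] []; do 2! case: neg_prod.
Qed.

End Diagonals.

(** * Index pairs and trios *)

(** The increasing normal form of an index pair, kept in naturals so that enumerations compute. *)
Definition valid (p : nat * nat) : bool := (0 < p.1 < p.2) && (p.2 < 16).

Definition pair_set (p : nat * nat) : {set 'I_16} :=
  [set inord p.1; inord p.2].

(** The four choices of signs reduce to two parities. *)
Definition linked (p q : nat * nat) : bool := annih false p q || annih true p q.

Lemma inord_neq (p : nat * nat) :
  valid p -> (inord p.1 : 'I_16) != inord p.2.
Proof.
case/andP=> /andP[_ p12] p16; have p1 := ltn_trans p12 p16.
by rewrite -val_eqE /= !inordK // ltn_eqF.
Qed.

Lemma val_inord_pair (p : nat * nat) : valid p ->
  (val (inord p.1 : 'I_16), val (inord p.2 : 'I_16)) = p.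
Proof.
case: p => a b /andP[/andP[_ ab] b16] /=; have a16 := ltn_trans ab b16.
by rewrite !inordK.
Qed.

Lemma pair_set_index p : valid p -> index_pair (pair_set p).
Proof.
move=> vp; rewrite /index_pair cards2 inord_neq //= !inE negb_or.
case/andP: (vp) => /andP[p0 p12] p16; have p1 := ltn_trans p12 p16.
by rewrite -!val_eqE /= !inordK // !ltn_eqF // (ltn_trans p0).
Qed.

Lemma index_pairP P : index_pair P -> exists2 p, valid p & P = pair_set p.
Proof.
case/andP=> /cards2P[A [B [AB ->]]]; rewrite !inE negb_or => /andP[A0 B0].
wlog ltAB : A B AB A0 B0 / A < B.
  move=> IH; case: (ltngtP A B) => [|ltBA|/val_inj e]; first exact: IH.
    by rewrite setUC; apply: IH => //; rewrite eq_sym.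
  by rewrite e eqxx in AB.
exists (val A, val B); last by rewrite /pair_set /= !inord_val.
by rewrite /valid /= ltAB ltn_ord lt0n eq_sym A0.
Qed.

Lemma pair_set_eq p (A B : 'I_16) : valid p -> pair_set p = [set A; B] ->
  A != B /\ ((val A, val B) = p \/ (val B, val A) = p).
Proof.
move=> vp eAB.
have AB : A != B.
  by have /andP[] := pair_set_index vp; rewrite eAB cards2; case: (A != B).
split=> //; rewrite -(val_inord_pair vp).
have := set21 A B; have := set22 A B; rewrite -eAB !inE.
case/orP=> /eqP eB /orP[] /eqP eA; rewrite eA eB ?eqxx in AB * => //.
- by right.
- by left.
Qed.

Lemma pair_set_eq_lt p (A B : 'I_16) :
  valid p -> A < B -> pair_set p = [set A; B] -> (val A, val B) = p.
Proof.
move=> vp AB /(pair_set_eq vp)[_ [//|]].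
by move: vp => /[swap] <- /andP[/andP[_]] /=; rewrite ltnNge ltnW.
Qed.

Lemma pair_set_inj : {in valid &, injective pair_set}.
Proof.
move=> p q vp vq /pair_set_eq_lt <- //; first by rewrite val_inord_pair.
by have := vq; rewrite -{1}(val_inord_pair vq) => /andP[/andP[_]].
Qed.

(** * Co-assessors and edge marks as computable tests *)

Section Edges.

Variable R : numDomainType.

Lemma co_assessorsE p q : valid p -> valid q ->
  co_assessors R (pair_set p) (pair_set q) = linked p q.
Proof.
move=> vp vq; rewrite /co_assessors !pair_set_index //=; apply/idP/idP.
  case/existsP=> A /existsP[B] /existsP[C] /existsP[D] /existsP[s] /existsP[t].
  case/and3P=> /eqP /(pair_set_eq vp)[AB pE] /eqP /(pair_set_eq vq)[CD qE].
  rewrite sed_mul_diagonals_eq0 // => ann.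
  (* The witnesses may list either pair in decreasing order; [annih] is insensitive to this. *)
  have {}ann : annih (s (+) t) p q.
    case: pE qE ann => <- [] <- //; first by rewrite annih_swapr.
      by rewrite annih_swapl.
    by rewrite annih_swapl annih_swapr.
  by rewrite /linked; case: (s (+) t) ann => ->; rewrite ?orbT.
move=> lpq; have [e ann] : exists e, annih e p q.
  by case/orP: lpq; [exists false | exists true].
apply/existsP; exists (inord p.1); apply/existsP; exists (inord p.2).
apply/existsP; exists (inord q.1); apply/existsP; exists (inord q.2).
(* The signs [s = e], [t = false] realise the parity [e]. *)
apply/existsP; exists e; apply/existsP; exists false; rewrite !eqxx !andTb.
by rewrite sed_mul_diagonals_eq0 ?inord_neq // !val_inord_pair // addbF.
Qed.

(** Treats both marks at once: [e = false] gives the mark [+] and [e = true] the mark [-]. *)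
Lemma edge_existsE (e : bool) (f : 'I_16 -> sedenion R) (p q : nat * nat) :
  (forall T, f T = (-1) ^+ e *: i_ R T)%R -> valid p -> valid q ->
  co_assessors R (pair_set p) (pair_set q) &&
  [exists a : 'I_16, exists S : 'I_16, exists b : 'I_16, exists T : 'I_16,
   [&& pair_set p == [set a; S], (a < S)%N, pair_set q == [set b; T], (b < T)%N &
       sed_mul (i_ R a + i_ R S) (i_ R b + f T) == 0]]%R
  = annih e p q.
Proof.
move=> fE vp vq; rewrite co_assessorsE //.
have diagE (a S b T : 'I_16) : a < S -> b < T ->
    (sed_mul (i_ R a + i_ R S) (i_ R b + f T) == 0)%R
    = annih e (val a, val S) (val b, val T).
  move=> aS bT; rewrite fE -[i_ R S]scale1r -(expr0 (-1)%R).
  by rewrite (@sed_mul_diagonals_eq0 _ _ _ _ _ false) ?addFb // -val_eqE ltn_eqF.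
apply/andP/idP => [[_]|ann].
  case/existsP=> a /existsP[S] /existsP[b] /existsP[T].
  case/and5P=> /eqP pE aS /eqP qE bT; rewrite diagE //.
  by rewrite (pair_set_eq_lt vp aS pE) (pair_set_eq_lt vq bT qE).
split; first by rewrite /linked; case: e ann {fE diagE} => ->; rewrite ?orbT.
have lt_inord r : valid r -> (inord r.1 : 'I_16) < (inord r.2 : 'I_16).
  by move=> vr; have := vr; rewrite -{1}(val_inord_pair vr) => /andP[/andP[]].
apply/existsP; exists (inord p.1); apply/existsP; exists (inord p.2).
apply/existsP; exists (inord q.1); apply/existsP; exists (inord q.2).
by rewrite !eqxx !lt_inord //= diagE ?lt_inord // !val_inord_pair.
Qed.

Lemma edge_plusE p q : valid p -> valid q ->
  edge_plus R (pair_set p) (pair_set q) = annih false p q.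
Proof.
apply: (@edge_existsE false (i_ R)) => T.
by rewrite expr0 scale1r.
Qed.

Lemma edge_minusE p q : valid p -> valid q ->
  edge_minus R (pair_set p) (pair_set q) = annih true p q.
Proof.
apply: (@edge_existsE true (fun T => - i_ R T)%R) => T.
by rewrite expr1 scaleN1r.
Qed.

End Edges.

(** Either entry of [p] may play the role of [A], and the two xors may come in either order. *)
Definition xor_pair (p q u : nat * nat) : bool :=
  u \in [:: (Nat.lxor p.1 q.1, Nat.lxor p.1 q.2);
            (Nat.lxor p.1 q.2, Nat.lxor p.1 q.1);
            (Nat.lxor p.2 q.1, Nat.lxor p.2 q.2);
            (Nat.lxor p.2 q.2, Nat.lxor p.2 q.1)].

Lemma xor_thirdE p q u : valid p -> valid q -> valid u ->
  xor_third (pair_set p) (pair_set q) (pair_set u) = xor_pair p q u.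
Proof.
move=> vp vq vu; apply/idP/idP.
  case/existsP=> A /existsP[B] /existsP[C] /existsP[D] /existsP[E] /existsP[F].
  case/and5P=> /eqP /(pair_set_eq vp)[_ pE] /eqP /(pair_set_eq vq)[_ qE].
  move=> /eqP /(pair_set_eq vu)[_ uE] /eqP eE /eqP eF.
  move: uE; rewrite /xor_pair !inE /= eE eF.
  by case: pE qE => <- [] <- [] <- /=; rewrite !eqxx ?orbT.
have xorP A B C D : pair_set p = [set A; B] -> pair_set q = [set C; D] ->
    (u == (Nat.lxor A C, Nat.lxor A D)) || (u == (Nat.lxor A D, Nat.lxor A C)) ->
    xor_third (pair_set p) (pair_set q) (pair_set u).
  move=> pE qE uE; apply/existsP; exists A; apply/existsP; exists B.
  apply/existsP; exists C; apply/existsP; exists D.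
  apply/existsP; exists (xor_ord A C); apply/existsP; exists (xor_ord A D).
  rewrite pE qE !eqxx /= !andbT; apply/eqP.
  have inord_xor (i j : 'I_16) : inord (Nat.lxor i j) = xor_ord i j.
    by apply: val_inj; rewrite /= inordK // lxor_lt16.
  by case/orP: uE => /eqP ->; rewrite /pair_set /= !inord_xor // setUC.
have inordV r : valid r ->
    (inord r.1 : 'I_16) = r.1 :> nat /\ (inord r.2 : 'I_16) = r.2 :> nat.
  by move/val_inord_pair; case: r => a b [].
have [[p1 p2] [q1 q2]] := (inordV p vp, inordV q vq).
rewrite /xor_pair !inE orbA => /orP[uE|uE].
  by apply: (xorP (inord p.1) (inord p.2) (inord q.1) (inord q.2));
     rewrite ?p1 ?q1 ?q2.
apply: (xorP (inord p.2) (inord p.1) (inord q.1) (inord q.2));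
  rewrite ?p2 ?q1 ?q2 //.
exact: setUC.
Qed.

(** * Enumeration of the trios *)

(** One representative per trio, ordered by smaller indices. These smaller indices form an O-trip as
    a set, and each of the seven O-trips occurs four times. *)
Definition trios : seq ((nat * nat) * (nat * nat) * (nat * nat)) :=
  [:: ((1, 10), (4, 15), (5, 14)); ((1, 10), (6, 13), (7, 12));
      ((1, 11), (4, 14), (5, 15)); ((1, 11), (6, 12), (7, 13));
      ((1, 12), (2, 15), (3, 14)); ((1, 12), (6, 11), (7, 10));
      ((1, 13), (2, 14), (3, 15)); ((1, 13), (6, 10), (7, 11));
      ((1, 14), (2, 13), (3, 12)); ((1, 14), (4, 11), (5, 10));
      ((1, 15), (2, 12), (3, 13)); ((1, 15), (4, 10), (5, 11));
      ((2, 9), (4, 15), (6, 13)); ((2, 9), (5, 14), (7, 12));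
      ((2, 11), (4, 13), (6, 15)); ((2, 11), (5, 12), (7, 14));
      ((2, 12), (5, 11), (7, 9)); ((2, 13), (4, 11), (6, 9));
      ((2, 14), (5, 9), (7, 11)); ((2, 15), (4, 9), (6, 11));
      ((3, 9), (4, 14), (7, 13)); ((3, 9), (5, 15), (6, 12));
      ((3, 10), (4, 13), (7, 14)); ((3, 10), (5, 12), (6, 15));
      ((3, 12), (5, 10), (6, 9)); ((3, 13), (4, 10), (7, 9));
      ((3, 14), (4, 9), (7, 10)); ((3, 15), (5, 9), (6, 10))].

Definition trio_seq (t : (nat * nat) * (nat * nat) * (nat * nat)) :=
  [:: t.1.1; t.1.2; t.2].

Definition trio_set t : {set {set 'I_16}} :=
  [set P in map pair_set (trio_seq t)].

Lemma set3_seq (T : finType) (x y z : T) :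
  [set x; y; z] = [set w in [:: x; y; z]].
Proof. by apply/setP=> w; rewrite !inE orbA. Qed.

Lemma trio_setE p q u :
  trio_set (p, q, u) = [set pair_set p; pair_set q; pair_set u].
Proof. by rewrite set3_seq. Qed.

(** Exhaustive search over the 105 valid pairs; a permutation appears because a trio is unordered
    while the list fixes an order. *)
Lemma trios_complete p q u : valid p -> valid q -> valid u ->
  linked p q -> linked p u -> linked q u -> xor_pair p q u ->
  exists2 t, t \in trios & perm_eq [:: p; q; u] (trio_seq t).
Proof.
pose pairs := [seq p <- [seq (a, b) | a <- iota 0 16, b <- iota 0 16] | valid p].
have mem_pairs r : valid r -> r \in pairs.
  case: r => a b vr; rewrite mem_filter vr; apply/allpairsP; exists (a, b).
  case/andP: vr => /andP[_ ab] b16.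
  by rewrite !mem_iota /= b16 (ltn_trans ab).
(* Only neighbours of [p] are tried for [q] and [u], and the [if] spares the search through [trios]
   when [q] and [u] are not linked. *)
have /allP check : all (fun p => let N := [seq r <- pairs | linked p r] in
    all (fun q => all (fun u => if linked q u then xor_pair p q u ==>
      has (fun t => perm_eq [:: p; q; u] (trio_seq t)) trios else true) N) N)
  pairs by vm_compute.
move=> vp vq vu lpq lpu lqu xpqu.
have /allP/(_ q) := check p (mem_pairs p vp).
rewrite mem_filter lpq mem_pairs // => /(_ isT) /allP/(_ u).
rewrite mem_filter lpu mem_pairs // => /(_ isT).
by rewrite lqu xpqu => /hasP.
Qed.

(** The reverse link from [u] to [p] serves to show that the last pair is an assessor. *)
Lemma trios_sound p q u : (p, q, u) \in trios ->
  [/\ [/\ valid p, valid q & valid u], uniq [:: p; q; u],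
      [/\ linked p q, linked p u, linked q u & linked u p] &
      xor_pair p q u].
Proof.
have /allP check : all (fun t => let: (p, q, u) := t in
    [&& [&& valid p, valid q & valid u], uniq [:: p; q; u],
      [&& linked p q, linked p u, linked q u & linked u p] & xor_pair p q u])
  trios by vm_compute.
by case/check/and4P => /and3P[? ? ?] ? /and4P[? ? ? ?] ?.
Qed.

Lemma trios_marks p q u : (p, q, u) \in trios ->
  [&& annih true p q, annih true p u & annih true q u]
  || (annih false p q + annih false p u + annih false q u == 2)
     && (annih true p q + annih true p u + annih true q u == 1).
Proof.
have /allP check : all (fun t => let: (p, q, u) := t in
    [&& annih true p q, annih true p u & annih true q u]
    || (annih false p q + annih false p u + annih false q u == 2)
       && (annih true p q + annih true p u + annih true q u == 1))
  trios by vm_compute.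
exact: check.
Qed.

Lemma trio_set_inj : {in trios &, injective trio_set}.
Proof.
move=> t t' tT t'T /setP eqT.
(* By computation, inclusion of one listed trio in another already forces equality; injectivity of
   [pair_set] carries this to sets. *)
have /allP/(_ t tT)/allP/(_ t' t'T) : all (fun t => all (fun t' =>
    all (mem (trio_seq t')) (trio_seq t) ==> (t == t')) trios) trios.
  by vm_compute.
move=> /implyP sub_eq; apply/eqP/sub_eq/allP=> r rt /=.
have valid_trio s : s \in trios -> {subset trio_seq s <= valid}.
  case: s => [[p q] u] /trios_sound[[vp vq vu] _ _ _] x.
  by rewrite !inE => /or3P[] /eqP->.
have : pair_set r \in map pair_set (trio_seq t') by
  have := eqT (pair_set r); rewrite !in_set (map_f pair_set rt).
case/mapP=> r' r't' eqr.
rewrite (pair_set_inj _ _ eqr) //; first exact: (valid_trio t).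
exact: (valid_trio t').
Qed.

(** * Counting and classifying the trios *)

Section Trios.

Variable R : numDomainType.

Lemma co_assessor_trioP T :
  reflect (exists2 t, t \in trios & T = trio_set t) (co_assessor_trio R T).
Proof.
apply: (iffP idP) => [/andP[_]|[[[p q] u] tT ->]].
  case/existsP=> P /existsP[Q] /existsP[U].
  case/and4P=> /eqP-> _ /and3P[PQ PU QU] xPQU.
  have /and3P[/index_pairP[p vp pE] /index_pairP[q vq qE] _] := PQ.
  have /and3P[_ /index_pairP[u vu uE] _] := PU.
  move: PQ PU QU xPQU; rewrite pE qE uE !co_assessorsE // xor_thirdE //.
  move=> lpq lpu lqu xpqu.
  have [t tT tE] := trios_complete vp vq vu lpq lpu lqu xpqu.
  exists t => //; rewrite set3_seq; apply/setP=> X; rewrite !in_set.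
  exact: (perm_mem (perm_map pair_set tE)).
have [[vp vq vu] uniq_t [lpq lpu lqu lup] xpqu] := trios_sound tT.
have assessorI P Q : co_assessors R P Q -> assessor R P.
  by move=> PQ; apply/existsP; exists Q.
apply/andP; split.
  rewrite cardsE; apply/eqP/(card_uniqP _).
  rewrite map_inj_in_uniq // => x y xs ys.
  apply: pair_set_inj.
    by move: xs; rewrite !inE => /or3P[] /eqP->.
  by move: ys; rewrite !inE => /or3P[] /eqP->.
apply/existsP; exists (pair_set p); apply/existsP; exists (pair_set q).
apply/existsP; exists (pair_set u); rewrite trio_setE eqxx /=.
rewrite !co_assessorsE // xor_thirdE // lpq lpu lqu xpqu !andbT /=.
(* Each pair is an assessor thanks to the next one in the cycle [p], [q], [u]. *)
rewrite (assessorI _ (pair_set q)) ?(assessorI (pair_set q) (pair_set u)) //=.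
- by rewrite (assessorI _ (pair_set p)) // co_assessorsE.
- by rewrite co_assessorsE.
- by rewrite co_assessorsE.
Qed.

Lemma card_co_assessor_trios :
  #|[set T : {set {set 'I_16}} | co_assessor_trio R T]| = 28.
Proof.
have -> : [set T | co_assessor_trio R T] = [set T in map trio_set trios].
  apply/setP=> T; rewrite !in_set; apply/co_assessor_trioP/mapP.
    by case=> t tT ->; exists t.
  by case=> t tT ->; exists t.
(* The number 28 is the length of the list, found by conversion; what remains is that the listed
   sets are distinct. *)
rewrite cardsE; apply/(card_uniqP _).
by rewrite (map_inj_in_uniq trio_set_inj).
Qed.

Lemma trefoil_or_triple_zigzag T :
  co_assessor_trio R T -> trefoil R T \/ triple_zigzag R T.
Proof.
move=> trioT; have /co_assessor_trioP[[[p q] u] tT TE] := trioT.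
have [[vp vq vu] _ _ _] := trios_sound tT.
have /orP[zigzag|tref] := trios_marks tT; [right|left].
  rewrite /triple_zigzag trioT.
  apply/existsP; exists (pair_set p); apply/existsP; exists (pair_set q).
  apply/existsP; exists (pair_set u).
  by rewrite TE trio_setE eqxx !edge_minusE.
rewrite /trefoil trioT.
apply/existsP; exists (pair_set p); apply/existsP; exists (pair_set q).
apply/existsP; exists (pair_set u).
by rewrite TE trio_setE eqxx !edge_minusE // !edge_plusE.
Qed.

End Trios.

Theorem mainTheorem2 (R : realType) :
  #|[set T : {set {set 'I_16}} | co_assessor_trio R T]| = 28 /\
  (forall T : {set {set 'I_16}},
     co_assessor_trio R T -> trefoil R T \/ triple_zigzag R T).
Proof.
split; first exact: card_co_assessor_trios.
exact: trefoil_or_triple_zigzag.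
Qed.
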